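(* Let $I,J\subset[n]$ be nonempty with $I\cup J=[n]$, $I\cap J=\emptyset$. Let $\mathcal V\subset(\mathbb{R}\cup\{-\infty\})^n$ be a finite set of vectors, none identically $-\infty$, such that for each $l\in[n]$ there is $v\in\mathcal V$ with $v_l\neq-\infty$. Define $T^{IJ}$ on $(\mathbb{R}\cup\{-\infty\})^n$ by $$T^{IJ}_l(x)=\begin{cases}\inf_{v\in\mathcal V,\,v_l\neq-\infty}\{-v_l+\max_{j\in J}(v_j+x_j)\}, & l\in I,\\ \inf_{v\in\mathcal V,\,v_l\neq-\infty}\{-v_l+\max_{i\in I}(v_i+x_i)\}, & l\in J.\end{cases}$$ Then $$\min_{a}\operatorname{dist}_H(\mathcal V,\mathcal H^{IJ}_a)=-\rho(T^{IJ})=\sup\{r\ge0:\exists w\in\mathbb{R}^n,\ B_{IJ}(w,r)\subset\operatorname{Span}(\mathcal V)\},$$ where the minimum is over $a\in(\mathbb{R}\cup\{-\infty\})^n$ not identically $-\infty$. The minimum is achieved by any such $b$ with $T^{IJ}(b)\ge\rho(T^{IJ})+b$. Moreover, if $\rho(T^{IJ})$ is finite, the supremum is achieved: there exists $c\in\mathbb{R}^n$ with $B_{IJ}(c,-\rho(T^{IJ}))\subset\operatorname{Span}(\mathcal V)$.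
   Context: $-\infty+c=-\infty$, $\max\emptyset=-\infty$. $\mathcal H^{IJ}_a=\{y:\max_{i\in I}(a_i+y_i)=\max_{j\in J}(a_j+y_j)\}$. Hilbert's projective metric $d(x,y)=\inf\{\lambda-\mu:\lambda,\mu\in\mathbb{R},\ \mu+y_l\le x_l\le\lambda+y_l\ \forall l\}$; $\operatorname{dist}_H(A,B)=\sup_{x\in A}\inf_{y\in B}d(x,y)$. $\operatorname{Span}(\mathcal V)$ is the tropical cone generated by $\mathcal V$ (entrywise maxima of vectors $\alpha+v$, $v\in\mathcal V$, $\alpha\in\mathbb{R}\cup\{-\infty\}$). $e^J\in\mathbb{R}^n$ has $e^J_l=0$ for $l\in I$ and $e^J_l=1$ for $l\in J$; the vertical interval is $B_{IJ}(w,r)=\{\lambda+w+\mu e^J:\mu\in[-r,r],\lambda\in\mathbb{R}\}$ for $w\in\mathbb{R}^n$, $r\in[0,+\infty]$. $\rho(T)=\sup\{\lambda\in\mathbb{R}\cup\{-\infty\}:\exists u\not\equiv-\infty,\ T(u)=\lambda+u\}$. *)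

(* Defs.v *)
From HB Require Import structures.
From mathcomp Require Import all_boot all_order all_algebra.
From mathcomp Require Import all_classical all_reals.
From mathcomp Require Import ereal.
Set Implicit Arguments. Unset Strict Implicit. Unset Printing Implicit Defensive.
Import Order.TTheory GRing.Theory Num.Theory.
Local Open Scope classical_set_scope.
Local Open Scope ring_scope.
Local Open Scope ereal_scope.

Section Trop.
Context {R : realType} {n : nat}.

(* a vector of (R ∪ {-oo})^n : no +oo entry *)
Definition tvec (x : 'I_n -> \bar R) : Prop := forall l, x l != +oo.
Definition nontriv (x : 'I_n -> \bar R) : Prop := exists l, x l != -oo.

(* max_{i in S} f i, with max of the empty set = -oo *)
Definition maxover (S : set 'I_n) (f : 'I_n -> \bar R) : \bar R :=
  ereal_sup [set f i | i in S].

Definition hyperplane (I J : set 'I_n) (a : 'I_n -> \bar R) : set ('I_n -> \bar R) :=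
  [set y | tvec y /\ maxover I (fun i => a i + y i) = maxover J (fun j => a j + y j)].

Definition hilbert_d (x y : 'I_n -> \bar R) : \bar R :=
  ereal_inf [set z | exists lam mu : R,
    (forall l, mu%:E + y l <= x l /\ x l <= lam%:E + y l) /\ z = (lam - mu)%R%:E].

Definition distH (A B : set ('I_n -> \bar R)) : \bar R :=
  ereal_sup [set ereal_inf [set hilbert_d x y | y in B] | x in A].

Definition Span (V : set ('I_n -> \bar R)) : set ('I_n -> \bar R) :=
  [set x | exists alpha : ('I_n -> \bar R) -> \bar R,
     (forall v, alpha v != +oo) /\
     forall l, x l = ereal_sup [set alpha v + v l | v in V]].

Definition TIJ (I J : set 'I_n) (V : set ('I_n -> \bar R)) (x : 'I_n -> \bar R) :
    'I_n -> \bar R := fun l =>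
  ereal_inf [set - v l + maxover (if `[< I l >] then J else I) (fun k => v k + x k)
            | v in [set v | V v /\ v l != -oo]].

Definition rho (T : ('I_n -> \bar R) -> ('I_n -> \bar R)) : \bar R :=
  ereal_sup [set lam | lam != +oo /\
     exists u, tvec u /\ nontriv u /\ T u = (fun l => lam + u l)].

Definition vinterval (J : set 'I_n) (w : 'I_n -> R) (r : \bar R) : set ('I_n -> \bar R) :=
  [set x | exists lam mu : R, - r <= mu%:E /\ mu%:E <= r /\
     x = (fun l => (lam + w l + mu * (if `[< J l >] then 1 else 0))%R%:E)].

End Trop.

(* Main.v *)
Require Import Defs.
From HB Require Import structures.
From mathcomp Require Import all_boot all_order all_algebra.
From mathcomp Require Import all_classical all_reals.
From mathcomp Require Import ereal.
From mathcomp Require Import ring lra.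
Set Implicit Arguments. Unset Strict Implicit. Unset Printing Implicit Defensive.
Import Order.TTheory GRing.Theory Num.Theory.
Local Open Scope classical_set_scope.
Local Open Scope ring_scope.
Local Open Scope ereal_scope.

(** The distance from [v] to the hyperplane of [a] is
    [|max_I (a + v) - max_J (a + v)|], so [distH V (hyperplane I J a) <= d] says
    exactly that [- d + a <= T a]: minimizing the distance is maximizing the
    [lam] for which [T] has a nontrivial vector [u] with [lam + u <= T u].

    A min-max-plus operator has a value: either [G w <= lam + w] has a finite
    solution [w] for every [lam], or some [lam] admits both such a [w] and a
    nontrivial [u] with [lam + u <= G u].  One splits the min and max nodes of
    the rows one at a time.  At a min node of row [l] the two vectors [u1], [u2]
    obtained for the two alternatives are shifted to agree at [l], and their
    entrywise maximum works; dually at a max node.  What remains is a functional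
    graph, solved by an explicit bias.  Tarski's argument between [u] and [w]
    then gives an eigenvector, so the value of [T] is [rho T].

    For the inner radius, a vertical interval of half-width [r] around [- z] is
    contained in the span as soon as [S z <= z], where [S] is the operator of
    the residuated projection on the span, with a penalty [r] on the coordinates
    lying on the other side of the partition.  If [lam + u <= S u] with [lam > 0],
    a maximal coordinate of [u + v] can only be dominated from the other side, so
    [lam - r + u <= T u]; for [r = - rho T] this is impossible, hence the value
    of [S] is at most [0] and the required finite [z] exists. *)

(** * Bias of a finite functional graph *)

(** Pigeonhole on the iterates of [f], taken as elements of a finite type of functions, so that [p]
    and [N] do not depend on [x]. *)
Lemma iter_eventually_periodic (T : finType) (f : T -> T) :
  exists p N : nat, (0 < N)%N /\ forall x, iter (p + N) f x = iter p f x.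
Proof.
pose m := #|{ffun T -> T}|.
pose g (i : 'I_m.+1) := [ffun x => iter i f x].
have /injectivePn[i [j ij gij]] : ~~ injectiveb g.
  apply/negP => /injectiveP /leq_card.
  by rewrite card_ord ltnn.
have {}gij x : iter i f x = iter j f x.
  by move/ffunP: gij => /(_ x); rewrite !ffunE.
have /orP[lt|lt] : (i < j)%N || (j < i)%N by rewrite -neq_ltn.
  by exists i, (j - i)%N; rewrite subn_gt0 lt; split=> // x; rewrite subnKC 1?ltnW.
by exists j, (i - j)%N; rewrite subn_gt0 lt; split=> // x; rewrite subnKC 1?ltnW.
Qed.

(* With [f^(p+N) = f^p], [lam] is the mean of [a] over a period; the periodic
   part of [h] is [- \sum_(i < N) i a(f^i x) / N], and the transient part adds
   the excess of [a] over [lam] along the first [p] steps. *)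
Lemma functional_graph_bias (R : realFieldType) (T : finType) (f : T -> T)
    (a : T -> R) :
  exists h lam : T -> R, forall x,
    (a x + h (f x) = lam x + h x)%R /\ lam (f x) = lam x.
Proof.
have [p [N [N0 pN]]] := iter_eventually_periodic f.
have NR : (N%:R != 0 :> R)%R by rewrite pnatr_eq0 -lt0n.
pose b x i := a (iter (p + i) f x).
have bS x i : b (f x) i = b x i.+1 by rewrite /b -iterSr addnS.
have bN x : b x N = b x 0%N by rewrite /b pN addn0.
pose lam x := ((\sum_(0 <= i < N) b x i) / N%:R)%R.
have lamf x : lam (f x) = lam x.
  rewrite /lam; congr (_ / _)%R.
  under eq_bigr do rewrite bS.
  rewrite -(big_add1 _ _ 0 N.+1 xpredT (b x)).
  case: N N0 {NR pN lam} bN => // N _ bN.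
  by rewrite big_nat_recr //= bN [RHS]big_nat_recl // big_add1 addrC.
pose s x := ((\sum_(0 <= i < N) i%:R * b x i) / N%:R)%R.
pose t x := (\sum_(0 <= i < p) (a (iter i f x) - lam x))%R.
exists (fun x => t x - s x)%R, lam => x; split=> //.
have tf : (t x - t (f x) = a x - b x 0%N)%R.
  rewrite /t lamf -sumrB.
  under eq_bigr do rewrite -iterSr opprB addrA subrK -opprB.
  by rewrite sumrN telescope_sumr // opprB /b addn0.
have sf : (s (f x) - s x = b x 0%N - lam x)%R.
  rewrite /s /lam -mulrBl -sumrB.
  (* Summation by parts; periodicity turns the boundary term [N * b x N] into [N * b x 0]. *)
  have -> : (\sum_(0 <= i < N) (i%:R * b (f x) i - i%:R * b x i) =
      \sum_(0 <= i < N) (i.+1%:R * b x i.+1 - i%:R * b x i)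
       - \sum_(0 <= i < N) b (f x) i)%R.
    by rewrite -sumrB; apply: eq_bigr => i _; rewrite bS -addn1 natrD; ring.
  rewrite telescope_sumr // mul0r subr0 bN mulrBl [(N%:R * _)%R]mulrC mulfK //.
  by have := lamf x; rewrite /lam => ->.
by have := lamf x; move: tf sf; lra.
Qed.

(** * Min-max terms and the value of a min-max-plus system *)

Section MinMax.
Context {R : realType} {n : nat}.
Implicit Types (x y z u : 'I_n -> \bar R) (w : 'I_n -> R) (lam c : R).

(** Rows are kept as syntax so that their nodes can be replaced one at a time. [Bot] is the empty
    maximum; no term denotes an empty minimum. *)
Inductive minmax_term : Type :=
| Bot
| Atom of R & 'I_n
| Min of minmax_term & minmax_term
| Max of minmax_term & minmax_term.

Fixpoint eval_term t z : \bar R :=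
  match t with
  | Bot => -oo
  | Atom a k => a%:E + z k
  | Min s t => Order.min (eval_term s z) (eval_term t z)
  | Max s t => Order.max (eval_term s z) (eval_term t z)
  end.

Fixpoint term_size t : nat :=
  match t with
  | Bot | Atom _ _ => 0
  | Min s t | Max s t => (term_size s + term_size t).+1
  end.

Definition eval_system (F : 'I_n -> minmax_term) z : 'I_n -> \bar R :=
  fun k => eval_term (F k) z.

(** Certificates from above are finite in every entry; those from below, in [super_eigen], may have
    [-oo] entries. *)
Definition sub_eigen (G : ('I_n -> \bar R) -> ('I_n -> \bar R)) lam w : Prop :=
  forall k, G (EFin \o w) k <= lam%:E + (w k)%:E.

Definition super_eigen (G : ('I_n -> \bar R) -> ('I_n -> \bar R)) lam u : Prop :=
  [/\ tvec u, nontriv u & forall k, lam%:E + u k <= G u k].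

Lemma le_eval_term t x y : (forall k, x k <= y k) -> eval_term t x <= eval_term t y.
Proof.
move=> xy; elim: t => [|a k|s IHs t IHt|s IHs t IHt] //=.
- exact: leeD2l.
- by rewrite le_min !ge_min IHs IHt orbT.
- by rewrite ge_max !le_max IHs IHt orbT.
Qed.

Lemma adde_min_fin c (a b : \bar R) :
  c%:E + Order.min a b = Order.min (c%:E + a) (c%:E + b).
Proof.
case: (leP a b) => ab; case: leP => //; rewrite ?leeD2lE ?lteD2lE // => h.
  by move: ab; rewrite leNgt h.
by move: ab; rewrite ltNge h.
Qed.

Lemma eval_term_shift t c z : eval_term t (fun k => c%:E + z k) = c%:E + eval_term t z.
Proof.
elim: t => [|a k|s IHs t IHt|s IHs t IHt] //=.
- by rewrite addeCA.
- by rewrite IHs IHt adde_min_fin.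
- by rewrite IHs IHt adde_maxr.
Qed.

Lemma sub_eigen_shift F lam w c : sub_eigen (eval_system F) lam w ->
  sub_eigen (eval_system F) lam (fun k => c + w k)%R.
Proof.
move=> Fw k; rewrite /eval_system.
have -> : EFin \o (fun k => c + w k)%R = fun k => c%:E + (EFin \o w) k by [].
by rewrite eval_term_shift EFinD addeCA leeD2lE// Fw.
Qed.

Lemma super_eigen_shift F lam u c : super_eigen (eval_system F) lam u ->
  super_eigen (eval_system F) lam (fun k => c%:E + u k).
Proof.
case=> tu [l ul] Fu; split.
- by move=> k; move: (tu k); case: (u k).
- by exists l; move: ul; case: (u l).
- by move=> k; rewrite /eval_system eval_term_shift addeCA leeD2lE// Fu.
Qed.

Lemma sub_eigen_le G lam mu w : (lam <= mu)%R -> sub_eigen G lam w -> sub_eigen G mu w.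
Proof. by move=> lm Gw k; apply: le_trans (Gw k) _; rewrite leeD2r// lee_fin. Qed.

Lemma super_eigen_le G lam mu u : (lam <= mu)%R -> super_eigen G mu u -> super_eigen G lam u.
Proof.
by move=> lm [? ? Gu]; split=> // k; apply: le_trans (Gu k); rewrite leeD2r// lee_fin.
Qed.

(** The first alternative means value [-oo], the second means value [lam]. *)
Definition has_value F : Prop :=
  (forall lam, exists w, sub_eigen (eval_system F) lam w) \/
  (exists lam, (exists w, sub_eigen (eval_system F) lam w) /\
               (exists u, super_eigen (eval_system F) lam u)).

Definition upd (F : 'I_n -> minmax_term) l t : 'I_n -> minmax_term :=
  fun k => if k == l then t else F k.

Lemma super_eigen_min F l s t lam u1 u2 : F l = Min s t ->
  super_eigen (eval_system (upd F l s)) lam u1 ->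
  super_eigen (eval_system (upd F l t)) lam u2 ->
  exists u, super_eigen (eval_system F) lam u.
Proof.
move=> Fl S1 S2; case: (S1) => t1 [i1 n1] F1; case: (S2) => t2 [i2 n2] F2.
(* If [u1 l = -oo], row [l] asks nothing of [u1], which then works alone. *)
case u1l : (u1 l) (t1 l) => [a1||] // _; last first.
  exists u1; split=> // [|k]; first by exists i1.
  have := F1 k; rewrite /eval_system /upd; case: eqP => // -> _.
  by rewrite u1l addeNy leNye.
case u2l : (u2 l) (t2 l) => [a2||] // _; last first.
  exists u2; split=> // [|k]; first by exists i2.
  have := F2 k; rewrite /eval_system /upd; case: eqP => // -> _.
  by rewrite u2l addeNy leNye.
have {S1 F1 n1}[t1' [j1 n1] F1] := super_eigen_shift (a2 - a1)%R S1.
set v1 := fun k => _ in t1' n1 F1.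
have v1l : v1 l = a2%:E by rewrite /v1 u1l -EFinD subrK.
pose u k := Order.max (v1 k) (u2 k).
have lev1 k : v1 k <= u k by rewrite /u le_max lexx.
have leu2 k : u2 k <= u k by rewrite /u le_max lexx orbT.
exists u; split.
- by move=> k; rewrite /u; case: leP.
- exists j1; apply: contra n1 => /eqP uj.
  by have := lev1 j1; rewrite uj leeNy_eq.
move=> k; have := F1 k; have := F2 k; rewrite /eval_system /upd.
case: eqP => [->|_] f2 f1.
  (* [v1], [u2] and [u] agree at [l], so each alternative bounds its own branch of the minimum. *)
  rewrite Fl /= /u v1l u2l maxxx le_min; apply/andP; split.
    by rewrite -v1l; apply: le_trans f1 _; apply: le_eval_term.
  by rewrite -u2l; apply: le_trans f2 _; apply: le_eval_term.
rewrite {1}/u adde_maxr ge_max; apply/andP; split.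
  by apply: le_trans f1 _; apply: le_eval_term.
by apply: le_trans f2 _; apply: le_eval_term.
Qed.

Lemma sub_eigen_max F l s t lam w1 w2 : F l = Max s t ->
  sub_eigen (eval_system (upd F l s)) lam w1 ->
  sub_eigen (eval_system (upd F l t)) lam w2 ->
  exists w, sub_eigen (eval_system F) lam w.
Proof.
move=> Fl /(sub_eigen_shift (w2 l - w1 l)%R).
set v1 := (fun k => _)%R => F1 F2.
have v1l : v1 l = w2 l by rewrite /v1 subrK.
pose w k := Order.min (v1 k) (w2 k).
have lev1 k : (EFin \o w) k <= (EFin \o v1) k by rewrite /= lee_fin ge_min lexx.
have lew2 k : (EFin \o w) k <= (EFin \o w2) k by rewrite /= lee_fin ge_min lexx orbT.
exists w => k; have := F1 k; have := F2 k; rewrite /eval_system /upd.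
case: eqP => [->|_] f2 f1.
  have -> : w l = w2 l by rewrite /w v1l minxx.
  rewrite Fl /= ge_max; apply/andP; split.
    by rewrite -v1l; exact: le_trans (le_eval_term _ lev1) f1.
  exact: le_trans (le_eval_term _ lew2) f2.
have [->|->] : w k = v1 k \/ w k = w2 k by rewrite /w; case: leP; [left|right].
  exact: le_trans (le_eval_term _ lev1) f1.
exact: le_trans (le_eval_term _ lew2) f2.
Qed.

(** Upper certificates pass to [F] from either branch and lower ones are combined, so the value is
    the minimum of the two. *)
Lemma has_value_min F l s t : F l = Min s t ->
  has_value (upd F l s) -> has_value (upd F l t) -> has_value F.
Proof.
move=> Fl.
have leFs k z : eval_term (F k) z <= eval_term (upd F l s k) z.
  by rewrite /upd; case: eqP => [->|//]; rewrite Fl /= ge_min lexx.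
have leFt k z : eval_term (F k) z <= eval_term (upd F l t k) z.
  by rewrite /upd; case: eqP => [->|//]; rewrite Fl /= ge_min lexx orbT.
have subs lam w : sub_eigen (eval_system (upd F l s)) lam w -> sub_eigen (eval_system F) lam w.
  by move=> h k; exact: le_trans (leFs _ _) (h k).
have subt lam w : sub_eigen (eval_system (upd F l t)) lam w -> sub_eigen (eval_system F) lam w.
  by move=> h k; exact: le_trans (leFt _ _) (h k).
case=> [h1 _|[lam1 [[w1 sw1] [u1 su1]]]].
  by left=> lam; have [w /subs] := h1 lam; exists w.
case=> [h2|[lam2 [[w2 sw2] [u2 su2]]]].
  by left=> lam; have [w /subt] := h2 lam; exists w.
right; exists (Order.min lam1 lam2); split.
  by case: leP => _; [exists w1; exact: subs | exists w2; exact: subt].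
apply: super_eigen_min Fl (super_eigen_le _ su1) (super_eigen_le _ su2).
  by rewrite ge_min lexx.
by rewrite ge_min lexx orbT.
Qed.

(** Here lower certificates pass and upper ones are combined, so the value is the maximum. *)
Lemma has_value_max F l s t : F l = Max s t ->
  has_value (upd F l s) -> has_value (upd F l t) -> has_value F.
Proof.
move=> Fl.
have leFs k z : eval_term (upd F l s k) z <= eval_term (F k) z.
  by rewrite /upd; case: eqP => [->|//]; rewrite Fl /= le_max lexx.
have leFt k z : eval_term (upd F l t k) z <= eval_term (F k) z.
  by rewrite /upd; case: eqP => [->|//]; rewrite Fl /= le_max lexx orbT.
have sups lam u : super_eigen (eval_system (upd F l s)) lam u -> super_eigen (eval_system F) lam u.
  by case=> ? ? h; split=> // k; exact: le_trans (h k) (leFs _ _).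
have supt lam u : super_eigen (eval_system (upd F l t)) lam u -> super_eigen (eval_system F) lam u.
  by case=> ? ? h; split=> // k; exact: le_trans (h k) (leFt _ _).
case=> [h1|[lam1 [[w1 sw1] [u1 su1]]]]; case=> [h2|[lam2 [[w2 sw2] [u2 su2]]]].
- left=> lam; have [w1 s1] := h1 lam; have [w2 s2] := h2 lam.
  exact: sub_eigen_max Fl s1 s2.
- right; exists lam2; split; last by exists u2; exact: supt.
  by have [w1 s1] := h1 lam2; exact: sub_eigen_max Fl s1 sw2.
- right; exists lam1; split; last by exists u1; exact: sups.
  by have [w2 s2] := h2 lam1; exact: sub_eigen_max Fl sw1 s2.
right; exists (Order.max lam1 lam2); split.
  apply: sub_eigen_max Fl (sub_eigen_le _ sw1) (sub_eigen_le _ sw2).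
    by rewrite le_max lexx.
  by rewrite le_max lexx orbT.
by case: leP => _; [exists u2; exact: supt | exists u1; exact: sups].
Qed.

(* Dead rows become self-loops; on the points that reach one, the weight of the
   loop can be set to any prescribed mean. *)
Lemma has_value_atomic (a : 'I_n -> R) (f : 'I_n -> 'I_n) (dead : pred 'I_n) F :
  (forall k, F k = if dead k then Bot else Atom (a k) (f k)) -> has_value F.
Proof.
move=> FE.
pose g k := if dead k then k else f k.
pose alive k := `[< forall i, ~~ dead (iter i g k) >].
have alive_dead k : alive k -> ~~ dead k by move=> /asboolP /(_ 0%N).
have aliveS k : alive k -> alive (g k).
  by move=> /asboolP h; apply/asboolP => i; rewrite -iterSr; exact: h.
have deadS k : ~~ dead k -> ~~ alive k -> ~~ alive (g k).
  move=> dk; apply: contra => /asboolP h; apply/asboolP => -[//|i].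
  by rewrite iterSr; exact: h.
have dead_bias lam : exists h : 'I_n -> R, forall k, ~~ alive k -> ~~ dead k ->
    (a k + h (f k) = lam + h k)%R.
  have [h [m hm]] := functional_graph_bias g (fun k => if dead k then lam else a k).
  exists h => k nk dk.
  suff mk : m k = lam by have [] := hm k; rewrite /g (negbTE dk) mk.
  have [i] : exists i, dead (iter i g k).
    by apply: contrapT => /forallNP ne; case/asboolP: nk => i; apply/negP/ne.
  have <- : m (iter i g k) = m k by elim: i => //= i <-; have [] := hm (iter i g k).
  move=> di; have [] := hm (iter i g k); rewrite /g di => + _.
  by move/addIr.
case: (pselect (exists k, alive k)) => [[k0 k0a]|none]; last first.
  left=> lam; have [h hE] := dead_bias lam; exists h => k.
  rewrite /eval_system FE; case: ifPn => [_|dk] /=; first exact: leNye.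
  by rewrite -!EFinD hE //; apply/negP => ak; apply: none; exists k.
have [h0 [m hm]] := functional_graph_bias g a.
(* The value is the largest mean weight among the orbits that never meet a dead row. *)
case: (@arg_maxP _ _ _ k0 alive m k0a) => k1 k1a mmax.
have [h1 h1E] := dead_bias (m k1).
right; exists (m k1); split.
  exists (fun k => if alive k then h0 k else h1 k) => k.
  rewrite /eval_system FE; case: ifPn => [_|dk] /=; first exact: leNye.
  have gk : g k = f k by rewrite /g (negbTE dk).
  have [ak|ak] := boolP (alive k); last first.
    by have := deadS _ dk ak; rewrite gk => /negbTE ->; rewrite -!EFinD h1E.
  have := aliveS _ ak; rewrite gk => ->.
  have [] := hm k; rewrite gk => e _.
  by rewrite -!EFinD lee_fin e lerD2r; exact: mmax.
(* The live points of maximal mean are closed under [f], and [h0] is an exact bias on them. *)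
exists (fun k => if alive k && (m k == m k1) then (h0 k)%:E else -oo); split.
- by move=> k; case: ifP.
- by exists k1; rewrite k1a eqxx.
move=> k; case: ifPn => [/andP[ak /eqP mk]|_]; last by rewrite addeNy leNye.
have dk := alive_dead _ ak.
have gk : g k = f k by rewrite /g (negbTE dk).
have := aliveS _ ak; have [] := hm k.
rewrite /eval_system FE (negbTE dk) gk /= => e -> ->.
by rewrite mk eqxx /= -!EFinD e mk.
Qed.

(** Induction on the total number of [Min] and [Max] nodes; without any, the system is a functional
    graph with dead rows. *)
Theorem minmax_system_has_value F : has_value F.
Proof.
have [N] := ubnP (\sum_k term_size (F k))%N; elim: N F => // N IH F.
rewrite ltnS => FN.
have updN l t : (term_size t < term_size (F l))%N ->
    (\sum_k term_size (upd F l t k) < N)%N.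
  move=> lt; apply: leq_trans FN.
  rewrite (bigD1 l) //= [X in (_ < X)%N](bigD1 l) //= -addSn.
  apply: leq_add; first by rewrite /upd eqxx.
  by apply: leq_sum => i il; rewrite /upd (negbTE il).
case: (pselect (exists l s t, F l = Min s t)) => [[l [s [t Fl]]]|nomin].
  by apply: (has_value_min Fl); apply: IH; apply: updN;
    rewrite Fl /= ltnS ?leq_addr ?leq_addl.
case: (pselect (exists l s t, F l = Max s t)) => [[l [s [t Fl]]]|nomax].
  by apply: (has_value_max Fl); apply: IH; apply: updN;
    rewrite Fl /= ltnS ?leq_addr ?leq_addl.
apply: (@has_value_atomic (fun k => if F k is Atom a _ then a else 0%R)
  (fun k => if F k is Atom _ j then j else k)
  (fun k => if F k is Bot then true else false)) => k.
case Fk : (F k) => [|a j|s t|s t] //.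
  by case: nomin; exists k, s, t.
by case: nomax; exists k, s, t.
Qed.

End MinMax.

(** * Extrema over finite sets *)

Section FiniteExtrema.
Context {R : realType} {A : eqType}.
Implicit Types (f : A -> \bar R) (S : set A).

Lemma finite_argmin f S : finite_set S -> S !=set0 ->
  exists2 a, S a & forall b, S b -> f a <= f b.
Proof.
move=> /finite_seqP[s ->] [a]; rewrite /= => as_.
suff: exists2 b, b \in s & forall c, c \in s -> f b <= f c.
  by move=> [b bs bmin]; exists b.
elim: s a as_ => // b [|c s] IH a _.
  by exists b; rewrite ?mem_head // => c; rewrite inE => /eqP->.
have [d ds dmin] := IH c (mem_head _ _).
have [le|lt] := leP (f b) (f d).
  exists b; rewrite ?mem_head // => e; rewrite inE => /orP[/eqP->//|/dmin].
  exact: le_trans.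
exists d; first by rewrite inE ds orbT.
by move=> e; rewrite inE => /orP[/eqP->|/dmin//]; exact: ltW.
Qed.

Lemma ereal_inf_attained f S : finite_set S -> S !=set0 ->
  exists2 a, S a & ereal_inf [set f b | b in S] = f a.
Proof.
move=> fS S0; have [a Sa amin] := finite_argmin f fS S0; exists a => //.
apply/le_anti/andP; split; first by apply: ereal_inf_lbound; exists a.
by apply/ereal_infP => _ [b Sb <-]; exact: amin.
Qed.

Lemma ereal_sup_attained f S : finite_set S -> S !=set0 ->
  exists2 a, S a & ereal_sup [set f b | b in S] = f a.
Proof.
move=> fS S0; have [a Sa amax] := finite_argmin (fun b => - f b) fS S0.
exists a => //; apply/le_anti/andP; split; last by apply: ereal_sup_ubound; exists a.
by apply/ereal_supP => _ [b Sb <-]; rewrite -leeN2; exact: amax.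
Qed.

Lemma ereal_sup_cons f a s :
  ereal_sup [set f b | b in [set` a :: s]] =
  Order.max (f a) (ereal_sup [set f b | b in [set` s]]).
Proof.
apply/le_anti/andP; split.
  apply/ereal_supP => _ [b /= + <-]; rewrite inE le_max => /orP[/eqP->|bs].
    by rewrite lexx.
  by apply/orP; right; apply: ereal_sup_ubound; exists b.
rewrite ge_max; apply/andP; split.
  by apply: ereal_sup_ubound; exists a => //=; rewrite mem_head.
by apply: ereal_sup_le => _ [b /= bs <-]; exists b => //=; rewrite inE bs orbT.
Qed.

Lemma ereal_inf_cons f a s :
  ereal_inf [set f b | b in [set` a :: s]] =
  Order.min (f a) (ereal_inf [set f b | b in [set` s]]).
Proof.
apply/le_anti/andP; split; last first.
  apply/ereal_infP => _ [b /= + <-]; rewrite inE ge_min => /orP[/eqP->|bs].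
    by rewrite lexx.
  by apply/orP; right; apply: ereal_inf_lbound; exists b.
rewrite le_min; apply/andP; split.
  by apply: ereal_inf_lbound; exists a => //=; rewrite mem_head.
by apply: ereal_inf_le_tmp => _ [b /= bs <-]; exists b => //=; rewrite inE bs orbT.
Qed.

End FiniteExtrema.

(** * Min-max-plus operators: comparison and eigenvectors *)

Section MinMaxOperators.
Context {R : realType} {n : nat}.
Implicit Types (z u : 'I_n -> \bar R) (w : 'I_n -> R) (lam c : R).
Implicit Types (G : ('I_n -> \bar R) -> ('I_n -> \bar R)).

Definition minmax_fun (f : ('I_n -> \bar R) -> \bar R) : Prop :=
  exists t, forall z, f z = eval_term t z.

Definition minmax_op G : Prop := forall l, minmax_fun (fun z => G z l).

Lemma minmax_fun_shift c f : minmax_fun f -> minmax_fun (fun z => c%:E + f z).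
Proof.
move=> [t ft].
suff [s st] : exists s, forall z, eval_term s z = c%:E + eval_term t z.
  by exists s => z; rewrite st ft.
elim: t {ft} => [|a k|s [s' es] t [t' et]|s [s' es] t [t' et]].
- by exists Bot.
- by exists (Atom (c + a)%R k) => z /=; rewrite EFinD addeA.
- by exists (Min s' t') => z /=; rewrite es et adde_min_fin.
- by exists (Max s' t') => z /=; rewrite es et adde_maxr.
Qed.

Lemma minmax_fun_sup (A : eqType) (S : set A) (f : A -> ('I_n -> \bar R) -> \bar R) :
  finite_set S -> (forall a, S a -> minmax_fun (f a)) ->
  minmax_fun (fun z => ereal_sup [set f a z | a in S]).
Proof.
move=> /finite_seqP[s ->]; elim: s => [|a s IH] fs.
  by exists Bot => z; rewrite set_nil image_set0 ereal_sup0.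
have [t et] := fs a (mem_head _ _).
have [|t' et'] := IH; first by move=> b /= bs; apply: fs; rewrite /= inE bs orbT.
by exists (Max t t') => z /=; rewrite (ereal_sup_cons (f^~ z)) et et'.
Qed.

(** Nonemptiness matters: an empty infimum is the constant [+oo], which no term denotes. *)
Lemma minmax_fun_inf (A : eqType) (S : set A) (f : A -> ('I_n -> \bar R) -> \bar R) :
  finite_set S -> S !=set0 -> (forall a, S a -> minmax_fun (f a)) ->
  minmax_fun (fun z => ereal_inf [set f a z | a in S]).
Proof.
move=> /finite_seqP[s ->] [a as_].
elim: s a as_ => // a [|b s] IH _ _ fs; have [t et] := fs a (mem_head _ _).
  by exists t => z; rewrite set_cons1 image_set1 ereal_inf1 et.
have [||t' et'] := IH b; first exact: mem_head.
  by move=> c cs; apply: fs; rewrite /= inE cs orbT.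
by exists (Min t t') => z /=; rewrite (ereal_inf_cons (f^~ z)) et et'.
Qed.

Lemma minmax_opE G : minmax_op G -> exists F, G = eval_system F.
Proof.
move=> /choice[F GF]; exists F; apply/funext => z; apply/funext => l.
exact: GF.
Qed.

Lemma minmax_op_le G x y : minmax_op G -> (forall k, x k <= y k) ->
  forall l, G x l <= G y l.
Proof. by move=> /minmax_opE[F ->] xy l; exact: le_eval_term. Qed.

Lemma minmax_op_shift G c z : minmax_op G ->
  G (fun k => c%:E + z k) = (fun k => c%:E + G z k).
Proof. by move=> /minmax_opE[F ->]; apply/funext => k; exact: eval_term_shift. Qed.

Lemma minmax_op_value G : minmax_op G ->
  (forall lam, exists w, sub_eigen G lam w) \/
  (exists lam, (exists w, sub_eigen G lam w) /\ (exists u, super_eigen G lam u)).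
Proof. by move=> /minmax_opE[F ->]; exact: minmax_system_has_value. Qed.

(** [c] is the maximum of [u - w], found by minimizing [w - u]; it is finite because [u] is
    nontrivial. *)
Lemma tight_domination u w : tvec u -> nontriv u ->
  exists c k0, (forall k, u k <= c%:E + (w k)%:E) /\ u k0 = c%:E + (w k0)%:E.
Proof.
move=> tu [l ul].
have [||k _ kmax] := @finite_argmin R 'I_n (fun k => (w k)%:E - u k) setT.
- exact: finite_finset.
- by exists l.
have uk : u k \is a fin_num.
  rewrite fin_numE tu andbT; apply: contra ul => /eqP uk.
  by have := kmax l I; rewrite uk; move: (tu l); case: (u l).
exists (fine (u k) - w k)%R, k; split; last by rewrite -EFinD subrK fineK.
move=> j; have := kmax j I; rewrite -(fineK uk); move: (tu j).
case: (u j) => [r||] // _ => [|_]; last exact: leNye.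
by rewrite -!EFinD !lee_fin; lra.
Qed.

(** At a point [k] where [u] touches [c + w] from below, [mu + u k <= G u k <= c + G w k <= lam + u
    k], and [u k] is finite. *)
Lemma super_eigen_le_sub_eigen G lam mu w u : minmax_op G ->
  sub_eigen G lam w -> super_eigen G mu u -> (mu <= lam)%R.
Proof.
move=> mG Gw [tu nu Gu]; have [c [k [ucw uk]]] := tight_domination w tu nu.
have := le_trans (Gu k) (minmax_op_le mG ucw k).
rewrite (minmax_op_shift c (EFin \o w)) // => /le_trans.
move=> /(_ _ (leeD2l c%:E (Gw k))).
by rewrite uk -!EFinD lee_fin; lra.
Qed.

(** [e] is the supremum of the vectors [b <= w] with [lam + b <= G b]; it belongs to this set and is
    its greatest element. *)
Lemma exists_eigenvector G lam w u : minmax_op G ->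
  sub_eigen G lam w -> super_eigen G lam u ->
  exists e, [/\ tvec e, nontriv e & G e = fun l => lam%:E + e l].
Proof.
move=> mG Gw [tu nu Gu]; have [c [k [ucw uk]]] := tight_domination w tu nu.
pose B := [set b | (forall l, lam%:E + b l <= G b l) /\ (forall l, b l <= (w l)%:E)].
pose e l := ereal_sup [set b l | b in B].
have ew l : e l <= (w l)%:E by apply/ereal_supP => _ [b [_ bw] <-].
have le_e b l : B b -> b l <= e l by move=> Bb; apply: ereal_sup_ubound; exists b.
have Ge l : lam%:E + e l <= G e l.
  rewrite -leeBrDl //; apply/ereal_supP => _ [b Bb <-]; rewrite leeBrDl //.
  by apply: le_trans (Bb.1 l) _; apply: minmax_op_le => // j; exact: le_e.
exists e; split.
- by move=> l; have := ew l; case: (e l).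
(* The translate of [u] touching [w] at [k] lies in [B], so [e k] is finite. *)
- exists k; have : (w k)%:E <= e k.
    have <- : (- c)%:E + u k = (w k)%:E by rewrite uk -!EFinD addKr.
    apply: (@le_e (fun l => (- c)%:E + u l)); split=> l.
      by rewrite minmax_op_shift // addeCA leeD2l.
    by rewrite EFinN addeC leeBlDl.
  by case: (e k).
apply/funext => l; apply/le_anti; rewrite Ge andbT.
have le_shift a b : (a <= lam%:E + b) = ((- lam)%:E + a <= b).
  by rewrite EFinN [- _ + a]addeC leeBlDl.
(* [G e - lam] is again in [B], hence below [e]. *)
rewrite le_shift; apply: (@le_e (fun l => (- lam)%:E + G e l)); split=> j.
  rewrite minmax_op_shift // addeCA leeD2l //.
  by have := minmax_op_le mG Ge j; rewrite minmax_op_shift.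
rewrite -le_shift; apply: le_trans (Gw j); exact: minmax_op_le.
Qed.

End MinMaxOperators.

(** * Distance to a hyperplane in terms of [TIJ] *)

Section Regression.
Context {R : realType} {n : nat}.
Implicit Types (I J A B : set 'I_n) (a u v x y z : 'I_n -> \bar R).
Implicit Types (V : set ('I_n -> \bar R)) (c d lam r : R).

Lemma le_maxover A f i : A i -> f i <= maxover A f :> \bar R.
Proof. by move=> Ai; apply: ereal_sup_ubound; exists i. Qed.

Lemma maxover_leP A (f : 'I_n -> \bar R) M :
  maxover A f <= M <-> (forall i, A i -> f i <= M).
Proof.
split=> [/ereal_supP h i Ai|h]; first by apply: h; exists i.
by apply/ereal_supP => _ [i Ai <-]; exact: h.
Qed.

Lemma eq_maxover A (f g : 'I_n -> \bar R) :
  (forall i, A i -> f i = g i) -> maxover A f = maxover A g.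
Proof. by move=> fg; congr ereal_sup; exact: eq_imagel. Qed.

Lemma maxover_attained A (f : 'I_n -> \bar R) : A !=set0 ->
  exists2 i, A i & maxover A f = f i.
Proof. exact/ereal_sup_attained/finite_finset. Qed.

Lemma maxover_shift A c (f : 'I_n -> \bar R) : A !=set0 ->
  maxover A (fun i => c%:E + f i) = c%:E + maxover A f.
Proof.
move=> A0; have [i Ai fi] := maxover_attained f A0.
apply/le_anti/andP; split; last by rewrite fi; exact: le_maxover.
by apply/maxover_leP => j Aj; rewrite leeD2l // le_maxover.
Qed.

Lemma maxover_tvec A x : A !=set0 -> tvec x -> maxover A x != +oo.
Proof. by move=> A0 tx; have [i _ ->] := maxover_attained x A0. Qed.

Lemma tvecD x y : tvec x -> tvec y -> tvec (fun l => x l + y l).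
Proof.
by move=> tx ty l; move: (tx l) (ty l); case: (x l) => [?||]; case: (y l).
Qed.

Lemma hyperplaneC I J a : hyperplane I J a = hyperplane J I a.
Proof. by apply/seteqP; split=> y [ty e]; split. Qed.

(** If [mu + y <= v <= lam + y] with [y] on the hyperplane, passing from [I] to [J] through [y]
    costs [lam - mu]. The infimum is approached up to [e]. *)
Lemma maxover_le_dist_hyperplane I J a v d :
  ereal_inf [set hilbert_d v y | y in hyperplane I J a] <= d%:E ->
  maxover I (fun i => a i + v i) <= d%:E + maxover J (fun j => a j + v j).
Proof.
move=> dist; apply/lee_addgt0Pr => e e0.
have /ereal_inf_lt[_ [y [_ H] <-]] :
    ereal_inf [set hilbert_d v y | y in hyperplane I J a] < (d + e)%:E.
  by apply: le_lt_trans dist _; rewrite lte_fin ltrDl.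
move=> /ereal_inf_lt[_ [lam [mu [h ->]]]]; rewrite lte_fin => lt.
apply: (@le_trans _ _ (lam%:E + maxover I (fun i => a i + y i))).
  apply/maxover_leP => i Ii; apply: le_trans (leeD2l _ (h i).2) _.
  by rewrite addeCA leeD2l // (@le_maxover _ (fun i => a i + y i)).
rewrite H; have : maxover J (fun j => a j + y j) <= (- mu)%:E + maxover J (fun j => a j + v j).
  apply/maxover_leP => j Jj.
  apply: le_trans (leeD2l _ (@le_maxover J (fun j => a j + v j) j Jj)).
  rewrite addeCA leeD2l // EFinN addeC leeBrDl //; exact: (h j).1.
move=> /(leeD2l lam%:E) /le_trans; apply.
by rewrite addeA [leRHS]addeAC leeD2r // -!EFinD lee_fin ltW.
Qed.

(** Lowering the [I]-entries of [v] by the gap [t] between the two maxima puts it on the hyperplane,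
    at Hilbert distance at most [t]. *)
Lemma dist_hyperplane_le I J a v d : J !=set0 -> I !=set0 -> I `&` J = set0 ->
  tvec a -> tvec v -> (0 <= d)%R ->
  maxover J (fun j => a j + v j) <= maxover I (fun i => a i + v i) ->
  maxover I (fun i => a i + v i) <= d%:E + maxover J (fun j => a j + v j) ->
  ereal_inf [set hilbert_d v y | y in hyperplane I J a] <= d%:E.
Proof.
move=> J0 I0 IJ0 ta tv d0 leJI leIJ.
have [t [t0 td tE]] : exists t, [/\ (0 <= t)%R, (t <= d)%R &
    maxover J (fun j => a j + v j) = (- t)%:E + maxover I (fun i => a i + v i)].
  have := maxover_tvec J0 (tvecD ta tv); have := maxover_tvec I0 (tvecD ta tv).
  move: leJI leIJ; case: (maxover I _) => [p||] //; case: (maxover J _) => [q||] //.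
    rewrite -EFinD !lee_fin => qp pq _ _; exists (p - q)%R.
    by split; [lra|lra|rewrite -EFinD; congr _%:E; lra].
  (* Both maxima are [-oo], and [v] is already on the hyperplane. *)
  by move=> _ _ _ _; exists 0%R.
pose y l := if `[< I l >] then (- t)%:E + v l else v l.
have yI l : I l -> y l = (- t)%:E + v l by rewrite /y => /asboolT ->.
have yJ l : J l -> y l = v l.
  rewrite /y => Jl; case: asboolP => // Il.
  by have : (I `&` J) l by []; rewrite IJ0.
apply: (@le_trans _ _ (hilbert_d v y)).
  apply: ereal_inf_lbound; exists y => //; split.
    by move=> l; rewrite /y; case: ifP => // _; move: (tv l); case: (v l).
  have -> : maxover J (fun j => a j + y j) = maxover J (fun j => a j + v j).
    by apply: eq_maxover => j /yJ ->.
  have -> : maxover I (fun j => a j + y j) = maxover I (fun j => (- t)%:E + (a j + v j)).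
    by apply: eq_maxover => j /yI ->; rewrite addeCA.
  by rewrite maxover_shift.
apply: (@le_trans _ _ (t - 0)%R%:E); last by rewrite subr0 lee_fin.
apply: ereal_inf_lbound; exists t, 0%R; split=> // l.
rewrite /y add0e; case: ifP => _; move: (tv l); case: (v l) => [s||] // _.
  by rewrite -!EFinD !lee_fin; split; lra.
by rewrite -!EFinD !lee_fin; split; lra.
Qed.

Lemma le_shift_shift d c (p q : \bar R) :
  ((- d)%:E + p <= - c%:E + q) = (p + c%:E <= d%:E + q).
Proof.
case: p q => [p||] [q||];
  rewrite -?EFinN -?EFinD ?(addeNy, addey, addNye, addye) ?(leey, leNye, lee_fin) //.
by apply/idP/idP; lra.
Qed.

(** Row [l] in [I] reads [a l + v l <= d + max_J (a + v)] for each [v], trivially true if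
    [v l = -oo]; the maximum over [I] gives the first inequality, and rows in [J] the second. *)
Lemma TIJ_geP I J V a d : I `|` J = setT -> I `&` J = set0 ->
  (forall v, V v -> tvec v) ->
  (forall l, (- d)%:E + a l <= TIJ I J V a l) <->
  (forall v, V v ->
    maxover I (fun i => a i + v i) <= d%:E + maxover J (fun j => a j + v j) /\
    maxover J (fun j => a j + v j) <= d%:E + maxover I (fun i => a i + v i)).
Proof.
move=> IJT IJ0 tV.
have maxoverC A v : maxover A (fun k => v k + a k) = maxover A (fun k => a k + v k).
  by apply: eq_maxover => k _; rewrite addeC.
have notI l : J l -> `[< I l >] = false.
  by move=> Jl; apply/asboolPn => Il; have : (I `&` J) l by []; rewrite IJ0.
split=> [h v Vv|h l].
  have key l : (v l != -oo -> (- d)%:E + a l <= - v l +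
      maxover (if `[< I l >] then J else I) (fun k => a k + v k)) ->
      a l + v l <= d%:E + maxover (if `[< I l >] then J else I) (fun k => a k + v k).
    case: (v l) (tV v Vv l) => [s||] // _ => [/(_ isT)|_]; last by rewrite addeNy leNye.
    by rewrite le_shift_shift.
  have {}key l := key l (fun vl => le_trans (h l) (ereal_inf_lbound
    (ex_intro2 _ _ v (conj Vv vl) (congr1 (fun m => - v l + m) (maxoverC _ v))))).
  split; apply/maxover_leP => l Al; have := key l.
    by rewrite asboolT.
  by rewrite notI.
apply/ereal_infP => _ [v [Vv vl] <-]; rewrite maxoverC.
have [hI hJ] := h v Vv.
case vlE : (v l) (tV v Vv l) vl => [s||] // _ _; rewrite le_shift_shift -vlE.
have : (I `|` J) l by rewrite IJT.
case=> Al; [rewrite asboolT // | rewrite notI //].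
  by apply: le_trans hI; exact: (@le_maxover I (fun i => a i + v i)).
by apply: le_trans hJ; exact: (@le_maxover J (fun i => a i + v i)).
Qed.

End Regression.

(** * Duality between the best hyperplane and the widest vertical interval *)

Section RegressionDuality.
Context {R : realType} {n : nat} (I J : set 'I_n) (V : set ('I_n -> \bar R)).
Hypotheses (I0 : I !=set0) (J0 : J !=set0).
Hypotheses (IJT : I `|` J = setT) (IJ0 : I `&` J = set0).
Hypotheses (finV : finite_set V) (tV : forall v, V v -> tvec v).
Hypothesis V_cover : forall l, exists v, V v /\ v l != -oo.
Implicit Types (a u v x y z : 'I_n -> \bar R) (w : 'I_n -> R) (c d lam r : R).

Let T := TIJ I J V.

Lemma asbool_compl l : `[< J l >] = ~~ `[< I l >].
Proof.
have [Il|nIl] := asboolP (I l).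
  by apply/asboolPn => Jl; have : (I `&` J) l by []; rewrite IJ0.
by apply/asboolP; have [] : (I `|` J) l by rewrite IJT.
Qed.

(** A [v] finite at a finite entry of [a] makes both maxima finite; adding the two inequalities
    gives [0 <= 2 d]. *)
Lemma super_eigen_TIJ_ge0 a d : super_eigen T (- d)%R a -> (0 <= d)%R.
Proof.
case=> ta [l al] /(TIJ_geP _ _ IJT IJ0 tV) h.
have [v [Vv vl]] := V_cover l; have [hI hJ] := h v Vv.
have tav := tvecD ta (tV Vv).
have avl : a l + v l != -oo by rewrite adde_eq_ninfty negb_or al.
have := maxover_tvec I0 tav; have := maxover_tvec J0 tav.
have : maxover I (fun i => a i + v i) != -oo \/ maxover J (fun i => a i + v i) != -oo.
  have : (I `|` J) l by rewrite IJT.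
  case=> Al; [left|right]; apply: contra avl => /eqP m.
    by have := @le_maxover R n I (fun i => a i + v i) l Al; rewrite m leeNy_eq.
  by have := @le_maxover R n J (fun i => a i + v i) l Al; rewrite m leeNy_eq.
move: hI hJ; case: (maxover I _) => [p||]; case: (maxover J _) => [q||] //.
  by rewrite -!EFinD !lee_fin => ? ? _ _ _; lra.
by move=> _ _ [].
Qed.

Lemma distH_hyperplane_leP a d : tvec a -> nontriv a ->
  distH V (hyperplane I J a) <= d%:E <-> super_eigen T (- d)%R a.
Proof.
move=> ta na; split=> [le|sup].
  split=> //; apply/(TIJ_geP _ _ IJT IJ0 tV) => v Vv.
  have dv : ereal_inf [set hilbert_d v y | y in hyperplane I J a] <= d%:E.
    by apply: le_trans le; apply: ereal_sup_ubound; exists v.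
  split; first exact: maxover_le_dist_hyperplane.
  by apply: maxover_le_dist_hyperplane; rewrite hyperplaneC.
have d0 := super_eigen_TIJ_ge0 sup.
case: sup => _ _ /(TIJ_geP _ _ IJT IJ0 tV) h.
apply/ereal_supP => _ [v Vv <-]; have [hI hJ] := h v Vv; have tv := tV Vv.
(* The side with the larger maximum is the one to be lowered. *)
have [le|/ltW le] := leP (maxover J (fun j => a j + v j)) (maxover I (fun i => a i + v i)).
  exact: dist_hyperplane_le.
by rewrite hyperplaneC; apply: dist_hyperplane_le => //; rewrite setIC.
Qed.

Lemma finite_rows l : finite_set [set v | V v /\ v l != -oo].
Proof. by apply: sub_finite_set finV => v []. Qed.

Lemma rows_nonempty l : [set v | V v /\ v l != -oo] !=set0.
Proof. by have [v Vv] := V_cover l; exists v. Qed.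

Lemma minmax_fun_row A (p : \bar R) (b : 'I_n -> \bar R) : p \is a fin_num -> tvec b ->
  minmax_fun (fun z : 'I_n -> \bar R => - p + maxover A (fun k => b k + z k)).
Proof.
move=> /fineK <- tb; apply: (@minmax_fun_shift _ _ (- fine p)%R).
apply: (@minmax_fun_sup _ _ _ A (fun k z => b k + z k)); first exact: finite_finset.
move=> k _; case: (b k) (tb k) => [q||] // _; last by exists Bot.
by exists (Atom q k).
Qed.

Lemma row_fin_num v l : V v -> v l != -oo -> v l \is a fin_num.
Proof. by move=> /tV/(_ l) tvl vl; rewrite fin_numE vl. Qed.

Lemma minmax_op_TIJ : minmax_op T.
Proof.
move=> l; apply: (@minmax_fun_inf _ _ _ _ (fun v z => - v l +
  maxover (if `[< I l >] then J else I) (fun k => v k + z k))).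
- exact: finite_rows.
- exact: rows_nonempty.
- by move=> v [Vv vl]; apply: minmax_fun_row; [exact: row_fin_num | exact: tV].
Qed.

(** The largest drop of [x k - x l] from the center of a vertical interval of half-width [r]: zero
    within a side of the partition, [r] across. *)
Definition penalty r (l k : 'I_n) : R := if `[< I k >] == `[< I l >] then 0%R else r.

Definition penalized_op r z : 'I_n -> \bar R := fun l =>
  ereal_inf [set - v l + maxover setT (fun k => v k + (penalty r l k)%:E + z k)
            | v in [set v | V v /\ v l != -oo]].

Lemma minmax_op_penalized r : minmax_op (penalized_op r).
Proof.
move=> l; apply: (@minmax_fun_inf _ _ _ _ (fun v z => - v l +
  maxover setT (fun k => v k + (penalty r l k)%:E + z k))).
- exact: finite_rows.
- exact: rows_nonempty.
- move=> v [Vv vl]; apply: minmax_fun_row; first exact: row_fin_num.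
  by apply: tvecD => //; exact: tV.
Qed.

(** At an index [i] maximizing [u + v] on [A], the gain [lam > 0] rules out a dominating index in
    [A]; one in [B] pays [r]. [A] and [B] stand for [I] and [J] in either order. *)
Lemma maxover_le_penalized A B r lam u v : A !=set0 -> (forall l, A l \/ B l) ->
  (forall l k, A l -> A k -> penalty r l k = 0%R) ->
  (forall l k, A l -> B k -> penalty r l k = r) ->
  tvec u -> V v -> (0 < lam)%R ->
  (forall l, lam%:E + u l <= penalized_op r u l) ->
  maxover A (fun k => u k + v k) <= (r - lam)%:E + maxover B (fun k => u k + v k).
Proof.
move=> A0 AB pA pB tu Vv lam0 h; have tv := tV Vv.
have [i Ai mi] := maxover_attained (fun k => u k + v k) A0; rewrite mi.
case ui : (u i) (tu i) => [p||] // _; last by rewrite addNye leNye.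
case vi : (v i) (tv i) => [q||] // _; last by rewrite addeNy leNye.
have vi0 : v i != -oo by rewrite vi.
have := le_trans (h i) (ereal_inf_lbound (ex_intro2 _ _ v (conj Vv vi0) erefl)).
rewrite ui vi.
have [|k _ ->] := @maxover_attained R n setT (fun k => v k + (penalty r i k)%:E + u k).
  by exists i.
have := AB k; case=> Xk; [rewrite pA // | rewrite pB //].
  have := @le_maxover R n A (fun k => u k + v k) k Xk; rewrite mi ui vi.
  case: (u k) (tu k) => [p'||] // _; case: (v k) (tv k) => [q'||] // _.
  by rewrite -!EFinD !lee_fin => ? ?; exfalso; lra.
move=> le; apply: (@le_trans _ _ ((r - lam)%:E + (u k + v k))).
  move: le; case: (u k) (tu k) => [p'||] // _; case: (v k) (tv k) => [q'||] // _.
  by rewrite -!EFinD !lee_fin => ?; lra.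
by rewrite leeD2l // (@le_maxover R n B (fun k => u k + v k)).
Qed.

Lemma super_eigen_penalized r lam u : (0 < lam)%R ->
  super_eigen (penalized_op r) lam u -> super_eigen T (lam - r)%R u.
Proof.
move=> lam0 [tu nu h]; split=> //; rewrite -opprB.
have IJl l : I l \/ J l by have : (I `|` J) l by rewrite IJT.
have nI l : J l -> `[< I l >] = false by move/asboolT; rewrite asbool_compl => /negbTE.
apply/(TIJ_geP _ _ IJT IJ0 tV) => v Vv.
split.
  apply: maxover_le_penalized => // l k; rewrite /penalty => /asboolT ->.
    by move=> /asboolT ->.
  by move=> /nI ->.
apply: maxover_le_penalized => // [l|l k|l k].
- by case: (IJl l); [right|left].
- by rewrite /penalty => /nI -> /nI ->.
- by rewrite /penalty => /nI -> /asboolT ->.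
Qed.

Lemma vinterval_sub_Span r w : (forall v, V v -> nontriv v) ->
  sub_eigen (penalized_op r) 0%R w ->
  vinterval J (fun l => - w l)%R r%:E `<=` Span V.
Proof.
move=> nV h x [lam [mu [rmu [mur xE]]]].
(* Residuation: the largest coefficient with [alpha v + v <= x]. It is not [+oo], since [v] has a
   finite entry. *)
pose alpha v : \bar R := if `[< V v >] then
  ereal_inf [set x k - v k | k in [set k | v k != -oo]] else -oo.
have xfin l : x l \is a fin_num by rewrite xE.
exists alpha; split=> [v|l].
  rewrite /alpha; case: asboolP => // Vv; have [k vk] := nV v Vv.
  have : x k - v k < +oo.
    by rewrite xE; case: (v k) vk (tV Vv k) => [s||] // _ _; rewrite -EFinB ltry.
  rewrite -ltey; apply: le_lt_trans; apply: ereal_inf_lbound; by exists k.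
apply/le_anti/andP; split; last first.
  apply/ereal_supP => _ [v Vv <-].
  have [->|vl] := eqVneq (v l) -oo; first by rewrite addeNy leNye.
  rewrite -leeBrDr; last exact: row_fin_num.
  by rewrite /alpha asboolT //; apply: ereal_inf_lbound; exists l.
(* The [v] attaining row [l] reaches [x l], whatever the point [x] of the interval. *)
have [v [Vv vl] vE] := ereal_inf_attained
  (fun v => - v l + maxover setT (fun k => v k + (penalty r l k)%:E + (EFin \o w) k))
  (finite_rows l) (rows_nonempty l).
have := h l; rewrite /penalized_op vE add0e => hv.
apply: le_ereal_sup_tmp; exists (alpha v + v l); first by exists v.
rewrite -leeBlDr; last exact: row_fin_num.
rewrite /alpha asboolT //; apply/ereal_infP => _ [k /= vk <-].
have : - v l + (v k + (penalty r l k)%:E + (w k)%:E) <= (w l)%:E.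
  apply: le_trans hv; rewrite leeD2l //.
  exact: (@le_maxover R n setT (fun k => v k + (penalty r l k)%:E + (EFin \o w) k)).
rewrite xE !asbool_compl /penalty.
case: (v l) vl (tV Vv l) => [p||] // _ _; case: (v k) vk (tV Vv k) => [q||] // _ _.
move: rmu mur; rewrite -!EFinN -!EFinD !lee_fin.
by case: `[< I k >]; case: `[< I l >] => /=; lra.
Qed.

Lemma sub_eigen_of_vinterval r w : (0 <= r)%R ->
  vinterval J w r%:E `<=` Span V ->
  sub_eigen T (- r)%R (fun l => - w l)%R.
Proof.
move=> r0 h l.
(* The endpoint at which the side opposite to [l] is lowest relative to entry [l]. *)
pose mu := (if `[< I l >] then - r else r)%R.
pose x k : \bar R := (0 + w k + mu * (if `[< J k >] then 1 else 0))%R%:E.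
have [alpha [alphay xE]] : Span V x.
  apply: h; exists 0%R, mu; rewrite -EFinN !lee_fin /mu.
  by split; [|split=> //]; case: ifP => _; lra.
have [|v Vv vE] := ereal_sup_attained (fun v => alpha v + v l) finV.
  by have [v []] := V_cover l; exists v.
have avk k : alpha v + v k <= x k by rewrite xE; apply: ereal_sup_ubound; exists v.
have := xE l; rewrite vE; case aE : (alpha v) => [s||] //; last first.
  by have := alphay v; rewrite aE.
case vl : (v l) (tV Vv l) => [p||] // _; rewrite -EFinD => -[xl].
apply: (@le_trans _ _ (- v l + maxover (if `[< I l >] then J else I)
   (fun k => v k + (- w k)%:E))).
  by apply: ereal_inf_lbound; exists v => //=; rewrite vl.
rewrite vl addeC leeBlDl //; apply/maxover_leP => k Ak.
have := avk k; rewrite aE; case: (v k) (tV Vv k) => [q||] // _ => [|_]; last first.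
  by rewrite addNye leNye.
rewrite /x -!EFinD !lee_fin; move: xl Ak; rewrite /mu !asbool_compl.
have [Il|nIl] := asboolP (I l) => /= xl.
  by move/asboolT; rewrite asbool_compl => ->; lra.
by move/asboolT => -> /=; lra.
Qed.

Lemma exists_vinterval r : (forall v, V v -> nontriv v) ->
  (forall lam u, super_eigen T lam u -> (lam <= - r)%R) ->
  exists w, vinterval J w r%:E `<=` Span V.
Proof.
move=> nV le_r; have [h|[lam [[w sw] [u su]]]] := minmax_op_value (minmax_op_penalized r).
  by have [w sw] := h 0%R; eexists; exact: vinterval_sub_Span sw.
(* A positive value would give [T] a super-eigenvector at [lam - r > - r]. *)
have lam0 : (lam <= 0)%R.
  rewrite leNgt; apply/negP => lam0.
  by have := le_r _ _ (super_eigen_penalized lam0 su); lra.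
by eexists; exact: vinterval_sub_Span nV (sub_eigen_le lam0 sw).
Qed.

Lemma vinterval_mono w (p q : \bar R) : p <= q -> vinterval J w p `<=` vinterval J w q.
Proof.
move=> pq x [lam [mu [h1 [h2 ->]]]]; exists lam, mu; split; [|split=> //].
  by apply: le_trans h1; rewrite leeN2.
exact: le_trans pq.
Qed.

(** [rho] only counts exact eigenvectors, so the lower bound needs [exists_eigenvector]. *)
Lemma rho_eq_value lam : (exists w, sub_eigen T lam w) ->
  (exists u, super_eigen T lam u) -> rho T = lam%:E.
Proof.
move=> [w sw] [u su]; apply/le_anti/andP; split.
  apply/ereal_supP => mu [muy [e [te [ne Te]]]].
  case: mu muy Te => [mu||] // _ Te; rewrite ?leNye // lee_fin.
  by apply: (super_eigen_le_sub_eigen minmax_op_TIJ sw (u := e)); split=> // k; rewrite Te.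
have [e [te ne Te]] := exists_eigenvector minmax_op_TIJ sw su.
by apply: ereal_sup_ubound; split=> //; exists e.
Qed.

Lemma rho_eq_ninfty : (forall lam, exists w, sub_eigen T lam w) -> rho T = -oo.
Proof.
move=> h; apply/eqP; rewrite -leeNy_eq; apply/ereal_supP => mu [muy [e [te [ne Te]]]].
case: mu muy Te => [mu||] // _ Te; exfalso.
have [w sw] := h (mu - 1)%R.
have : (mu <= mu - 1)%R; last by lra.
by apply: (super_eigen_le_sub_eigen minmax_op_TIJ sw (u := e)); split=> // k; rewrite Te.
Qed.

End RegressionDuality.

(** * The duality theorem, by cases on whether the value of [T] is finite *)

Theorem theorem5p8 (R : realType) (n : nat) (I J : set 'I_n)
  (V : set ('I_n -> \bar R)) :
  I !=set0 -> J !=set0 -> I `|` J = setT -> I `&` J = set0 ->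
  finite_set V ->
  (forall v, V v -> tvec v /\ nontriv v) ->
  (forall l, exists v, V v /\ v l != -oo) ->
  let T := TIJ I J V in
  let mindist := ereal_inf [set distH V (hyperplane I J a) | a in [set a | tvec a /\ nontriv a]] in
  [/\ (exists a, [/\ tvec a, nontriv a & distH V (hyperplane I J a) = mindist]),
      mindist = - rho T,
      - rho T = ereal_sup [set r | 0 <= r /\ exists w : 'I_n -> R, vinterval J w r `<=` Span V],
      (forall b, tvec b -> nontriv b -> (forall l, rho T + b l <= T b l) ->
          distH V (hyperplane I J b) = mindist)
    & (rho T \is a fin_num ->
         exists c : 'I_n -> R, vinterval J c (- rho T) `<=` Span V)].
Proof.
move=> I0 J0 IJT IJ0 finV tnV cover T mindist.
have tV v : V v -> tvec v by move=> /tnV[].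
have nV v : V v -> nontriv v by move=> /tnV[].
have mT : minmax_op T by exact: minmax_op_TIJ.
have distP := distH_hyperplane_leP I0 J0 IJT IJ0 tV cover.
have exv := exists_vinterval I0 J0 IJT IJ0 finV tV cover nV.
have mindist_le a : tvec a -> nontriv a -> mindist <= distH V (hyperplane I J a).
  by move=> ta na; apply: ereal_inf_lbound; exists a.
have [h|[lam [sub sup]]] := minmax_op_value mT.
  (* Value [-oo]: every hyperplane is at infinite distance, and the span contains vertical intervals
     of every finite half-width. *)
  have rhoE : rho T = -oo by exact: rho_eq_ninfty.
  have no_super lam u : ~ super_eigen T lam u.
    move=> su; have [w sw] := h (lam - 1)%R.
    by have := super_eigen_le_sub_eigen mT sw su; lra.
  have distE a : tvec a -> nontriv a -> distH V (hyperplane I J a) = +oo.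
    move=> ta na; have no d : ~ (distH V (hyperplane I J a) <= d%:E).
      by move=> /(distP a d ta na) /no_super.
    case E : (distH _ _) => [d||] //; first by case: (no d); rewrite E.
    by case: (no 0%R); rewrite E leNye.
  have minE : mindist = +oo.
    apply/eqP; rewrite -leye_eq; apply/ereal_infP => _ [a [ta na] <-].
    by rewrite distE.
  have [i0 _] := I0.
  rewrite minE rhoE /=; split=> //.
  - have n0 : nontriv (fun _ : 'I_n => 0 : \bar R) by exists i0.
    by exists (fun _ => 0); split=> //; exact: distE.
  - apply/esym/eqyP => r r0; apply: ereal_sup_ubound.
    split; first by rewrite lee_fin ltW.
    by apply: exv => mu u /no_super.
  - by move=> b tb nb _; exact: distE.
have rhoE : rho T = lam%:E by exact: rho_eq_value.
have le_lam mu u : super_eigen T mu u -> (mu <= lam)%R.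
  by have [w sw] := sub; exact: super_eigen_le_sub_eigen.
have lam0 : (lam <= 0)%R.
  have [u su] := sup; have := @super_eigen_TIJ_ge0 _ _ _ _ _ I0 J0 IJT IJ0 tV cover u (- lam)%R.
  by rewrite opprK oppr_ge0; exact.
have dist_ge a : tvec a -> nontriv a -> (- lam)%:E <= distH V (hyperplane I J a).
  move=> ta na; rewrite leNgt; apply/negP => lt.
  have [d dle dlt] : exists2 d, distH V (hyperplane I J a) <= d%:E & (d < - lam)%R.
    move: lt; case: (distH _ _) => [d||] //; first by rewrite lte_fin; exists d.
    by move=> _; exists (- lam - 1)%R; rewrite ?leNye //; lra.
  by have := le_lam _ _ ((distP a d ta na).1 dle); lra.
have distE a : super_eigen T lam a -> distH V (hyperplane I J a) = (- lam)%:E.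
  move=> sa; have [ta na _] := sa; apply/le_anti; rewrite dist_ge // andbT.
  by apply/distP; rewrite ?opprK.
have minE : mindist = (- lam)%:E.
  apply/le_anti/andP; split.
    by have [u su] := sup; rewrite -(distE u) //; case: su => *; exact: mindist_le.
  by apply/ereal_infP => _ [a [ta na] <-]; exact: dist_ge.
have [c Vc] : exists c, vinterval J c (- lam)%:E `<=` Span V.
  by apply: exv => mu u /le_lam; rewrite opprK.
rewrite minE rhoE -EFinN; split=> //.
- by have [u su] := sup; exists u; rewrite (distE u su); case: su.
- apply/le_anti/andP; split.
    by apply: ereal_sup_ubound; split; [rewrite lee_fin oppr_ge0 | exists c].
  apply/ereal_supP => p [p0 [w Vw]].
  rewrite leNgt; apply/negP => lt.
  (* As [p] may be [+oo], a real [q > - lam] below it is used; its interval would yield a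
     sub-eigenvector of [T] at [- q < lam]. *)
  have [q q0 qp] : exists2 q : R, (0 <= q /\ - lam < q)%R & q%:E <= p.
    case: p p0 lt {Vw} => [p||] // p0 lt; first by exists p; rewrite // -lee_fin -lte_fin.
    by exists (- lam + 1)%R; [split; lra | rewrite leey].
  have [u su] := sup.
  have := super_eigen_le_sub_eigen mT (sub_eigen_of_vinterval IJT IJ0 finV tV cover
     q0.1 (subset_trans (vinterval_mono qp) Vw)) su.
  by case: q0; lra.
- by move=> b tb nb Tb; apply: distE.
- by move=> _; exists c.
Qed.
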